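(* Let $X\subset\mathbb{S}^3$ be a spherical $\{10,4,2\}$-design. Then $|X|\ge12$. Moreover, $|X|=12$ if and only if $X$ is a $(4,12,1/2)$ spherical code with $A(X)\subset\{-1/2,0,1/2\}$.
   Context: $\mathrm{Harm}_\ell(\mathbb{R}^d)$ is the real space of homogeneous harmonic polynomials of degree exactly $\ell$ in $d$ variables. For $T\subset\mathbb{N}$, a nonempty finite $X\subset\mathbb{S}^{d-1}$ is a spherical $T$-design if $\sum_{x\in X}P(x)=0$ for all $P\in\mathrm{Harm}_\ell(\mathbb{R}^d)$, $\ell\in T$. For $X\subset\mathbb{S}^{d-1}$, $A(X)=\{\langle x,y\rangle: x,y\in X, x\ne y\}$. A set $X$ of $N$ points of $\mathbb{S}^{d-1}$ is a $(d,N,a)$ spherical code if every element of $A(X)$ is $\le a$. *)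

(* Defs.v *)
From HB Require Import structures.
From mathcomp Require Import all_boot all_order all_algebra.
From mathcomp Require Import finmap.
From mathcomp Require Import mpoly.
From mathcomp Require Import reals.

Set Implicit Arguments.
Unset Strict Implicit.
Unset Printing Implicit Defensive.

Import Order.TTheory GRing.Theory Num.Theory.
Local Open Scope ring_scope.
Local Open Scope fset_scope.

Definition dot (R : realType) (d : nat) (x y : 'rV[R]_d) : R :=
  \sum_(i < d) x 0 i * y 0 i.

(* Unit Euclidean length; the library norm on matrices is the sup norm. *)
Definition on_sphere (R : realType) (d : nat) (x : 'rV[R]_d) : Prop :=
  dot x x = 1.

Definition laplacian (R : realType) (d : nat) (P : {mpoly R[d]}) : {mpoly R[d]} :=
  \sum_(i < d) (P^`M(i))^`M(i).

(* [dhomog] contains 0 in every degree, so this is a linear subspace. *)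
Definition Harm (R : realType) (d l : nat) (P : {mpoly R[d]}) : Prop :=
  P \is l.-homog /\ laplacian P = 0.

Definition spherical_design (R : realType) (d : nat) (T : {pred nat})
    (X : {fset 'rV[R]_d}) : Prop :=
  [/\ X != fset0,
      (forall x, x \in X -> on_sphere x) &
      forall l, l \in T -> forall P : {mpoly R[d]}, Harm l P ->
        \sum_(x <- X) P.@[fun i => x 0 i] = 0].

Definition inner_products (R : realType) (d : nat) (X : {fset 'rV[R]_d}) : {fset R} :=
  [fset dot x y | x in X, y in X & x != y].

Definition spherical_code (R : realType) (d N : nat) (a : R)
    (X : {fset 'rV[R]_d}) : Prop :=
  [/\ (forall x, x \in X -> on_sphere x),
      #|` X| = N &
      forall t, t \in inner_products X -> t <= a].

(* Main.v *)
Require Import Defs.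
From HB Require Import structures.
From mathcomp Require Import all_boot all_order all_algebra.
From mathcomp Require Import finmap.
From mathcomp Require Import mpoly.
From mathcomp Require Import reals.
From mathcomp Require Import ring lra.

(** Linear programming bound. On the 3-sphere the zonal harmonics of degree [l]
are the Chebyshev polynomials of the second kind [U_l (dot x y)], so a
[{10, 4, 2}]-design [X] satisfies [\sum_(y in X) U_l (dot x y) = 0] for every
[x] and [l = 2, 4, 10]. The combination [F = 3 + 4 U_2 + 2 U_4 + U_10] is
nonnegative on the whole line, vanishes exactly at [0] and [+-1/2], and has
[F 1 = 36]. For [x] in [X], summing [F (dot x y)] over [y] in [X] gives
[3 |X| = 36 + \sum_(y != x) F (dot x y) >= 36], with equality only if all
the inner products with [x] are zeros of [F]. *)

Import Order.TTheory GRing.Theory Num.Theory.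
Local Open Scope ring_scope.

(** * Homogenized Chebyshev polynomials of the second kind *)

(* The homogenization [q^(n/2) U_n (a / sqrt q)], written without division. *)
Fixpoint chebyshevU {A : comNzRingType} (a q : A) (n : nat) : A :=
  match n with
  | 0 => 1
  | m.+1 => match m with
            | 0 => a *+ 2
            | k.+1 => a *+ 2 * chebyshevU a q m - q * chebyshevU a q k
            end
  end.

Lemma chebyshevUSS (A : comNzRingType) (a q : A) n :
  chebyshevU a q n.+2 = a *+ 2 * chebyshevU a q n.+1 - q * chebyshevU a q n.
Proof. by []. Qed.

Lemma pair_ind (P : nat -> Prop) :
  P 0%N -> P 1%N -> (forall n, P n -> P n.+1 -> P n.+2) -> forall n, P n.
Proof.
move=> P0 P1 PSS n; suff [] : P n /\ P n.+1 by [].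
by elim: n => [//|n [Pn PSn]]; split; last exact: PSS.
Qed.

(** Applied to [meval], this turns a zonal polynomial into a scalar Chebyshev value. *)
Lemma rmorph_chebyshevU (A B : comNzRingType) (f : {rmorphism A -> B}) a q n :
  f (chebyshevU a q n) = chebyshevU (f a) (f q) n.
Proof.
elim/pair_ind: n => [||n IHn IHSn]; first exact: rmorph1.
  by rewrite /= rmorphMn.
by rewrite !chebyshevUSS rmorphB !rmorphM rmorphMn IHn IHSn.
Qed.

(** * Product rules for the Laplacian and first-order operators *)

Section Laplacian.
Variables (R : realType) (d : nat).
Implicit Types (x y : 'rV[R]_d) (f g : {mpoly R[d]}) (v : 'I_d -> {mpoly R[d]}).

(** Constant coefficients give a directional derivative, the coordinates ['X_i] the Euler operator,
    and the gradient of a polynomial the cross term of [laplacianM]. *)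
Definition vfderiv v f : {mpoly R[d]} := \sum_(i < d) v i * f^`M(i).

Lemma vfderivB v f g : vfderiv v (f - g) = vfderiv v f - vfderiv v g.
Proof.
rewrite /vfderiv -sumrB; apply: eq_bigr => i _.
by rewrite mderivB mulrBr.
Qed.

Lemma vfderivMn v f n : vfderiv v (f *+ n) = vfderiv v f *+ n.
Proof.
rewrite /vfderiv -sumrMnl; apply: eq_bigr => i _.
by rewrite mderivMn mulrnAr.
Qed.

Lemma vfderiv1 v : vfderiv v 1 = 0.
Proof. by rewrite /vfderiv big1 // => i _; rewrite -mpolyC1 mderivC mulr0. Qed.

Lemma vfderivM v f g : vfderiv v (f * g) = vfderiv v f * g + f * vfderiv v g.
Proof.
rewrite /vfderiv mulr_suml mulr_sumr -big_split; apply: eq_bigr => i _ /=.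
by rewrite mderivM; ring.
Qed.

Lemma laplacianB f g : laplacian (f - g) = laplacian f - laplacian g.
Proof.
rewrite /laplacian -sumrB; apply: eq_bigr => i _.
by rewrite !mderivB.
Qed.

Lemma laplacianMn f n : laplacian (f *+ n) = laplacian f *+ n.
Proof.
rewrite /laplacian -sumrMnl; apply: eq_bigr => i _.
by rewrite !mderivMn.
Qed.

Lemma laplacian1 : laplacian (1 : {mpoly R[d]}) = 0.
Proof.
by rewrite /laplacian big1 // => i _; rewrite -mpolyC1 mderivC mderiv0.
Qed.

Lemma laplacianM f g :
  laplacian (f * g) =
  laplacian f * g + vfderiv (fun i => f^`M(i)) g *+ 2 + f * laplacian g.
Proof.
rewrite /laplacian /vfderiv mulr_suml mulr_sumr -sumrMnl -!big_split /=.
by apply: eq_bigr => i _; rewrite mderivM !mderivD !mderivM; ring.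
Qed.

Lemma eq_vfderiv v1 v2 f : v1 =1 v2 -> vfderiv v1 f = vfderiv v2 f.
Proof. by move=> e; apply: eq_bigr => i _; rewrite e. Qed.

Lemma mderivU (i j : 'I_d) : ('X_j : {mpoly R[d]})^`M(i) = (j == i)%:R.
Proof.
rewrite mderivX mnm1E; case: eqP => [->|_]; last by rewrite scale0r.
by rewrite scale1r -{1}[U_(i)%MM]add0m addmK mpolyX0.
Qed.

(** * The linear form of a vector and the squared norm *)

Definition linform (x : 'rV[R]_d) : {mpoly R[d]} := \sum_(i < d) x 0 i *: 'X_i.

Definition sqnorm : {mpoly R[d]} := \sum_(i < d) 'X_i ^+ 2.

Lemma mderiv_linform x i : (linform x)^`M(i) = (x 0 i)%:MP.
Proof.
rewrite /linform linear_sum (bigD1 i) //= big1 => [|j ji].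
  by rewrite addr0 mderivZ mderivU eqxx alg_mpolyC.
by rewrite mderivZ mderivU (negPf ji) scaler0.
Qed.

Lemma mderiv_sqnorm i : sqnorm^`M(i) = 'X_i *+ 2.
Proof.
rewrite /sqnorm linear_sum (bigD1 i) //= big1 => [|j ji].
  by rewrite addr0 expr2 mderivM mderivU eqxx mul1r mulr1.
by rewrite expr2 mderivM mderivU (negPf ji) mul0r mulr0 addr0.
Qed.

Lemma laplacian_linform x : laplacian (linform x) = 0.
Proof.
by rewrite /laplacian big1 // => i _; rewrite mderiv_linform mderivC.
Qed.

Lemma laplacian_sqnorm : laplacian sqnorm = (2 * d)%:R.
Proof.
rewrite /laplacian (eq_bigr (fun=> 2%:R)) => [|i _].
  by rewrite sumr_const card_ord -mulrnA.
by rewrite mderiv_sqnorm mderivMn mderivU eqxx.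
Qed.

Notation dirderiv x := (vfderiv (fun i => (x 0 i)%:MP)).
Notation euler := (vfderiv (fun i => 'X_i)).

Lemma laplacian_linformM x f :
  laplacian (linform x * f) = dirderiv x f *+ 2 + linform x * laplacian f.
Proof.
rewrite laplacianM laplacian_linform mul0r add0r.
by rewrite (eq_vfderiv _ _ _ (mderiv_linform x)).
Qed.

Lemma laplacian_sqnormM f :
  laplacian (sqnorm * f) =
  f *+ (2 * d) + euler f *+ 4 + sqnorm * laplacian f.
Proof.
rewrite laplacianM laplacian_sqnorm mulr_natl; congr (_ + _ + _).
rewrite (eq_vfderiv _ _ _ mderiv_sqnorm) /vfderiv -!sumrMnl.
by apply: eq_bigr => i _; rewrite mulrnAl -mulrnA.
Qed.

Lemma euler_linform x : euler (linform x) = linform x.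
Proof.
by apply: eq_bigr => i _; rewrite mderiv_linform mulrC mul_mpolyC.
Qed.

Lemma euler_sqnorm : euler sqnorm = sqnorm *+ 2.
Proof.
rewrite /sqnorm -sumrMnl; apply: eq_bigr => i _.
by rewrite mderiv_sqnorm mulrnAr expr2.
Qed.

Lemma dirderiv_linform x : dirderiv x (linform x) = (dot x x)%:MP.
Proof.
rewrite /dot rmorph_sum; apply: eq_bigr => i _.
by rewrite mderiv_linform rmorphM.
Qed.

Lemma dirderiv_sqnorm x : dirderiv x sqnorm = linform x *+ 2.
Proof.
rewrite /linform -sumrMnl; apply: eq_bigr => i _.
by rewrite mderiv_sqnorm mulrnAr mul_mpolyC.
Qed.

Lemma linform_dhomog x : linform x \is 1.-homog.
Proof. by apply: rpred_sum => i _; rewrite rpredZ // dhomogX /= mdeg1. Qed.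

Lemma sqnorm_dhomog : sqnorm \is 2.-homog.
Proof.
by apply: rpred_sum => i _; apply: (@dhomogMn _ _ _ 1); rewrite dhomogX /= mdeg1.
Qed.

Lemma meval_linform x y : (linform x).@[fun i => y 0 i] = dot x y.
Proof.
rewrite /linform rmorph_sum; apply: eq_bigr => i _.
by rewrite /= mevalZ mevalXU.
Qed.

Lemma meval_sqnorm (y : 'rV[R]_d) : sqnorm.@[fun i => y 0 i] = dot y y.
Proof.
rewrite /sqnorm rmorph_sum; apply: eq_bigr => i _.
by rewrite /= expr2 mevalM mevalXU.
Qed.

(** * Zonal harmonics and their sums over a design *)

Definition zonal (x : 'rV[R]_d) n := chebyshevU (linform x) sqnorm n.

Lemma meval_zonal x y n : on_sphere y ->
  (zonal x n).@[fun i => y 0 i] = chebyshevU (dot x y) 1 n.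
Proof.
move=> y1; rewrite /zonal (rmorph_chebyshevU _ _ (meval (fun i => y 0 i))).
by rewrite /= meval_linform meval_sqnorm y1.
Qed.

Lemma zonal_dhomog x n : zonal x n \is n.-homog.
Proof.
rewrite /zonal; elim/pair_ind: n => [||n IHn IHSn]; first exact: dhomog1.
  by rewrite /= rpredMn ?linform_dhomog.
rewrite chebyshevUSS rpredB //.
  rewrite -[n.+2]add1n; apply: dhomogM => //.
  by rewrite rpredMn ?linform_dhomog.
rewrite -[n.+2]add2n; apply: dhomogM => //; exact: sqnorm_dhomog.
Qed.

(** [linform x] and [sqnorm] have Euler weights 1 and 2, so both terms of the recursion for index
    [n.+2] have weight [n.+2]. *)
Lemma euler_zonal x n : euler (zonal x n) = zonal x n *+ n.
Proof.
rewrite /zonal; elim/pair_ind: n => [||n IHn IHSn].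
- by rewrite vfderiv1 mulr0n.
- by rewrite /= vfderivMn euler_linform.
rewrite chebyshevUSS vfderivB !vfderivM vfderivMn euler_linform euler_sqnorm.
by rewrite IHn IHSn; ring.
Qed.

(** Write [a] for [linform x] and [q] for [sqnorm]. Since [a] has derivative 1 and [q] has
    derivative [2a], differentiating the recursion for [U_(n+3)] gives
    [2 U_(n+2) + (n+2) (2a U_(n+1) - q U_n)], and the bracket is again [U_(n+2)]. *)
Lemma dirderiv_zonal x n : on_sphere x ->
  dirderiv x (zonal x n.+1) = zonal x n *+ n.+2.
Proof.
move=> x1; rewrite /zonal.
elim/pair_ind: n => [||n IHn IHSn].
- by rewrite /= vfderivMn dirderiv_linform x1.
- rewrite chebyshevUSS vfderivB !vfderivM /= !vfderivMn vfderiv1.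
  by rewrite dirderiv_linform dirderiv_sqnorm x1 mpolyC1; ring.
rewrite chebyshevUSS vfderivB !vfderivM vfderivMn IHn IHSn.
by rewrite dirderiv_linform dirderiv_sqnorm x1 mpolyC1 chebyshevUSS; ring.
Qed.

End Laplacian.

Arguments zonal {R d} x n.

(** This is where dimension 4 enters: by induction the Laplacian of [U_(n+2)] reduces to [4(n+2) U_n
    - (2d + 4n) U_n = (8 - 2d) U_n], which cancels for [d = 4]. *)
Lemma zonal_harm (R : realType) (x : 'rV[R]_4) n :
  on_sphere x -> Harm n (zonal x n).
Proof.
move=> x1; split; first exact: zonal_dhomog.
elim/pair_ind: n => [||n IHn IHSn]; first exact: laplacian1.
  by rewrite /zonal /= laplacianMn laplacian_linform mul0rn.
rewrite /zonal chebyshevUSS laplacianB mulrnAl laplacianMn.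
rewrite laplacian_linformM laplacian_sqnormM -!/(zonal _ _).
by rewrite dirderiv_zonal // euler_zonal IHn IHSn; ring.
Qed.

Lemma design_sum_chebyshevU (R : realType) (T : {pred nat})
    (X : {fset 'rV[R]_4}) (x : 'rV[R]_4) (l : nat) :
  spherical_design T X -> on_sphere x -> l \in T ->
  \sum_(y <- X) chebyshevU (dot x y) 1 l = 0.
Proof.
case=> _ X1 XT x1 lT; rewrite -[RHS](XT l lT _ (zonal_harm _ _ l x1)).
by apply: eq_big_seq => y yX /=; rewrite meval_zonal //; apply: X1.
Qed.

(** * The test polynomial of the linear programming bound *)

Definition testF {R : comNzRingType} (t : R) : R :=
  3%:R + 4%:R * chebyshevU t 1 2 + 2%:R * chebyshevU t 1 4 + chebyshevU t 1 10.

(** The roots 0 and +-1/2 are double and the last factor is at least 3 over the reals, so both the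
    sign and the zero set of [testF] can be read off. *)
Lemma testF_factor (R : comNzRingType) (t : R) :
  testF t = t ^+ 2 * (4%:R * t ^+ 2 - 1) ^+ 2
            * ((8%:R * t ^+ 2 - 7%:R) ^+ 2 + 3%:R).
Proof. by rewrite /testF /=; ring. Qed.

Lemma testF_ge0 (R : realType) (t : R) : 0 <= testF t.
Proof.
rewrite testF_factor mulr_ge0 //; first by rewrite mulr_ge0 ?sqr_ge0.
by rewrite addr_ge0 ?sqr_ge0 ?ler0n.
Qed.

Lemma testF_eq0 (R : realType) (t : R) :
  testF t = 0 -> t \in [fset - (1 / 2); 0; 1 / 2]%fset.
Proof.
have gt0 : 0 < (8%:R * t ^+ 2 - 7%:R) ^+ 2 + 3%:R :> R.
  by rewrite ltr_wpDl ?sqr_ge0 ?ltr0n.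
rewrite testF_factor => /eqP; rewrite !mulf_eq0 (gt_eqF gt0) orbF !orbb !inE.
case: (t =P 0) => [_ _|_ /=]; first by rewrite orbT.
have -> : 4%:R * t ^+ 2 - 1 = 4%:R * ((t + 1 / 2) * (t - 1 / 2)) by field.
by rewrite !mulf_eq0 pnatr_eq0 /= subr_eq0 addr_eq0 orbF.
Qed.

(** * The bound and the case of equality *)

Local Open Scope fset_scope.

Theorem theorem3p2 (R : realType) (X : {fset 'rV[R]_4}) :
  spherical_design (mem [:: 10; 4; 2]%N) X ->
  (12 <= #|` X|)%N /\
  (#|` X| = 12%N <->
     spherical_code 12 (1 / 2) X /\
     inner_products X `<=` [fset - (1 / 2); 0; 1 / 2]).
Proof.
move=> desX; have [X0 X1 _] := desX.
have sumF x : x \in X ->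
    \sum_(y <- X `\ x) testF (dot x y) = 3%:R * #|` X|%:R - 36%:R.
  move=> xX; have x1 := X1 x xX.
  have F1 : testF (dot x x) = 36%:R by rewrite x1 testF_factor; ring.
  (* Moving 36 across restores the term [y = x], so the sum runs over all of [X] and the design
     property applies. *)
  apply/eqP; rewrite eq_sym subr_eq addrC -F1 -(big_fsetD1 x xX) /=.
  have := fun l => design_sum_chebyshevU _ _ _ _ l desX x1; rewrite /testF.
  (* Abstracting [chebyshevU] keeps simplification from unfolding it at 2, 4 and 10. Only the
     constant term 3 survives the summation. *)
  move: chebyshevU => U sumU; rewrite !big_split -!mulr_sumr /= !sumU //.
  rewrite !mulr0 !addr0 big_const_seq count_predT iter_addr_0.
  by apply/eqP; ring.
split.
  have /fset0Pn[x xX] := X0.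
  rewrite -(ler_nat R); have := sumF x xX.
  have : 0 <= \sum_(y <- X `\ x) testF (dot x y).
    by apply: sumr_ge0 => y _; apply: testF_ge0.
  lra.
(* The converse is immediate, as the cardinality is part of [spherical_code]. *)
split=> [cardX|[[]//]].
have sub : inner_products X `<=` [fset - (1 / 2); 0; 1 / 2].
  apply/fsubsetP => t /imfset2P[x xX [y yXx ->]].
  apply: testF_eq0; move: yXx; rewrite !inE => /andP[yX xy].
  have := sumF x xX; rewrite cardX.
  (* With 12 points the nonnegative values of [testF] sum to 0, so each of them vanishes. *)
  have -> : 3%:R * 12%:R - 36%:R = 0 :> R by ring.
  move=> /eqP; rewrite psumr_eq0; last by move=> z _; apply: testF_ge0.
  by move=> /allP/(_ y); rewrite !inE eq_sym xy yX => /(_ isT)/eqP.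
split=> //; split=> // t /(fsubsetP sub).
by rewrite !inE => /orP[/orP[]|] /eqP->; lra.
Qed.
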